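(* Let $0<\alpha<\frac16$ and let $n>0$ be a multiple of $6$. Then a uniformly random labeled silhouette graph of size $n$ admits an $ab$-cycle of size at least $2$ and at most $n^\alpha$ with probability $1-O(n^{-\alpha})$ (as $n\to\infty$ along multiples of 6).
   Context: A labeled silhouette graph of size $n$ ($n$ a positive multiple of 6) is a connected graph with vertex set $[n]=\{1,\dots,n\}$ whose $a$-edges (undirected) are the 2-cycles of a fixpoint-free permutation $\sigma_2$ of $[n]$ all of whose cycles have length 2, and whose $b$-edges (directed, $v\to\sigma_3(v)$) are given by a fixpoint-free permutation $\sigma_3$ of $[n]$ all of whose cycles have length 3. Connectedness means that the group generated by $\sigma_2,\sigma_3$ is transitive on $[n]$. Labeled silhouette graphs of size $n$ are thus in bijection with such pairs $(\sigma_2,\sigma_3)$, and ''uniformly random'' refers to the uniform distribution on them. An $ab$-cycle of size $m$ is a cycle of length $m$ of the permutation $v\mapsto\sigma_3(\sigma_2(v))$ (follow the $a$-edge at $v$, then the outgoing $b$-edge); it corresponds to a loop labeled $(ab)^m$, with $m$ minimal. *)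

(* Defs.v *)
From mathcomp Require Import all_boot all_order all_algebra all_fingroup.
From mathcomp Require Import all_classical all_reals all_analysis.

Set Implicit Arguments.
Unset Strict Implicit.
Unset Printing Implicit Defensive.

Import Order.TTheory GRing.Theory Num.Theory.
Import numFieldNormedType.Exports.

Local Open Scope ring_scope.

(* Vertices are numbered from 0.  A labeled silhouette graph is encoded by its
   pair (sigma_2, sigma_3); fixpoint-freeness is part of the requirement that
   every cycle has length 2 (resp. 3). *)
Definition is_silhouette (n : nat) (g : {perm 'I_n} * {perm 'I_n}) : bool :=
  [&& [forall v, #|porbit g.1 v| == 2%N],
      [forall v, #|porbit g.2 v| == 3%N]
    & [transitive <<[set g.1; g.2]>>%g, on [set: 'I_n] | 'P]].

Definition silhouettes (n : nat) : {set {perm 'I_n} * {perm 'I_n}} :=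
  [set g | is_silhouette g].

(* Products of permutations are read left to right:
   (g.1 * g.2) v = sigma_3 (sigma_2 v). *)
Definition ab_perm (n : nat) (g : {perm 'I_n} * {perm 'I_n}) : {perm 'I_n} :=
  (g.1 * g.2)%g.

Definition has_short_ab_cycle (R : realType) (alpha : R) (n : nat)
    (g : {perm 'I_n} * {perm 'I_n}) : bool :=
  [exists c in porbits (ab_perm g),
     (2 <= #|c|)%N && (#|c|%:R <= n%:R `^ alpha :> R)].

Definition finset_prob (R : realType) (T : finType) (A : {set T})
    (E : pred T) : R :=
  #|[set x in A | E x]|%:R / #|A|%:R.

(* A notation rather than a definition, so that the filter instance of [within]
   is found by the [=O_F] notation. *)
Notation oo_multiples_of d :=
  (within [set n : nat | (d %| n)%N]%classic \oo%classic).

(* Main.v *)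
Require Import Defs.
From mathcomp Require Import all_classical all_reals all_analysis.
From mathcomp Require Import all_boot all_order all_algebra all_fingroup.
From mathcomp Require Import zify ring lra.

Set Implicit Arguments.
Unset Strict Implicit.
Unset Printing Implicit Defensive.

Import Order.TTheory GRing.Theory Num.Theory.
Import numFieldNormedType.Exports.

(** Put N = floor(n^alpha), fix b = sigma_3 and let a = sigma_2 be a uniform
    perfect matching.  For each set L of lengths in [2, N], choose at random one
    vertex for every position of a family of cycles with lengths L, and rewire a
    so that these cycles become ab-cycles.  Rewiring is injective once the old
    neighbours are remembered, and, unless two of the chosen vertices are joined
    by a short ab-walk or a short ab-walk from a chosen vertex collides with
    itself, it turns a matching without ab-cycles of length in [2, N] into one
    whose ab-cycles of such lengths are exactly the planted ones.  Each of the
    latter matchings arises from prod_(m in L) m choices of vertices, so up to an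
    error O(N^5 / n), which is O(1 / N) because alpha < 1/6,
      P(no short cycle) <= prod_(m in L) m * P(short lengths are L).
    Dividing by the product and summing over L, the factor on the left becomes
    prod_(2 <= m <= N) (1 + 1/m) = (N + 1) / 2, so P(no short cycle) = O(1 / N).

    Connectedness costs a factor 2: the expected number of invariant vertex sets
    of size 6t <= n/2 is C(3q,3t) C(2q,2t) / C(6q,6t) <= 1 / C(q,t) <= 1 / q,
    where n = 6q. *)

(** * Counting in finite types *)

Section Counting.

Lemma card_setX_dep (A B : finType) (D : {set A}) (F : A -> {set B}) :
  #|[set p | (p.1 \in D) && (p.2 \in F p.1)]| = \sum_(x in D) #|F x|.
Proof.
under eq_bigr => x _ do rewrite -sum1_card.
by rewrite (pair_big_dep (mem D) (fun x y => y \in F x)) /= sum1dep_card.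
Qed.

Lemma leq_card_bigcup (I B : finType) (P : pred I) (F : I -> {set B}) :
  #|\bigcup_(i | P i) F i| <= \sum_(i | P i) #|F i|.
Proof.
elim/big_rec2: _ => [|i m U _ IH]; first by rewrite cards0.
by rewrite (leq_trans (leq_card_setU _ _)) // leq_add2l.
Qed.

Lemma card_pair_swap (A B : finType) (P : A -> B -> bool) :
  #|[set p | P p.1 p.2]| = \sum_y #|[set x | P x y]|.
Proof.
under eq_bigr => y _ do rewrite -sum1dep_card.
by rewrite (exchange_big_dep predT) //= pair_big_dep /= sum1dep_card.
Qed.

(** Resampling coordinate [j] while remembering its old value is injective. As [i != j], the value
    [v i] is untouched, so the old value still lies in the set [F (v i)] of size at most [c]. In
    probabilistic terms, the event has probability at most c / |T|. *)
Lemma card_ffun_rel (I T : finType) (F : T -> {set T}) (c : nat) (i j : I) :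
  i != j -> (forall y, #|F y| <= c) ->
  #|[set v : {ffun I -> T} | v j \in F (v i)]| * #|T| <= c * #|T| ^ #|I|.
Proof.
move=> ij Fc; rewrite -card_ffun.
rewrite -[X in _ * X]cardsT -cardsX.
pose f (p : {ffun I -> T} * T) := ([ffun k => if k == j then p.2 else p.1 k], p.1 j).
have f_inj : injective f.
  move=> [v z] [v' z'] [/ffunP e1 e2]; congr (_, _).
    apply/ffunP=> k; have [->//|kj] := eqVneq k j.
    by have := e1 k; rewrite !ffunE /= (negbTE kj).
  by have := e1 j; rewrite !ffunE /= eqxx.
rewrite -(card_imset _ f_inj).
apply: (@leq_trans #|[set p : {ffun I -> T} * T | (p.1 \in setT) && (p.2 \in F (p.1 i))]|).
  apply: subset_leq_card; apply/subsetP=> _ /imsetP[[v z] + ->].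
  by rewrite !inE /= !ffunE (negbTE ij) andbT.
rewrite (card_setX_dep _ (fun v : {ffun I -> T} => F (v i))).
apply: (@leq_trans (\sum_(v in [set: {ffun I -> T}]) c)); first exact: leq_sum.
by rewrite sum_nat_const cardsT mulnC.
Qed.

End Counting.

(** * Self-collisions of ab-walks *)

Section Matchings.
Variable T : finType.
Implicit Types (a b : {perm T}) (x y z : T).

Definition matchings : {set {perm T}} := [set a | [forall x, #|porbit a x| == 2]].

Lemma porbit_stable a y x : (a y \in porbit a x) = (y \in porbit a x).
Proof. by rewrite -!eq_porbit_mem (porbit_perm a 1). Qed.

Lemma matchingP a :
  reflect (forall x, a x != x /\ a (a x) = x) (a \in matchings).
Proof.
rewrite inE; apply: (iffP forallP) => aP x.
  have /eqP cx := aP x; split; last by have := iter_porbit a x; rewrite cx.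
  by have := uniq_traject_porbit a x; rewrite cx /= !inE andbT eq_sym.
have [nx aax] := aP x.
suff -> : porbit a x = [set x; a x] by rewrite cards2 [x == _]eq_sym nx.
apply/setP=> y; rewrite !inE; apply/porbitP/idP => [[i ->]|/orP[]/eqP->].
- rewrite permX; elim: i => [|i] /=; first by rewrite eqxx.
  by case/orP=> /eqP->; rewrite ?aax eqxx ?orbT.
- by exists 0; rewrite expg0 perm1.
- by exists 1; rewrite expg1.
Qed.

Lemma permJ_tperm a p z y :
  (a ^ tperm p z)%g y = tperm p z (a (tperm p z y)).
Proof. by rewrite -{1}[y](tpermK p z) permJ. Qed.

Lemma matchingJ a t : a \in matchings -> (a ^ t)%g \in matchings.
Proof.
move=> /matchingP aP; apply/matchingP=> x.
have [y ->] : exists y, x = t y by exists ((t^-1)%g x); rewrite permKV.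
by have [ny ay] := aP y; rewrite !permJ ay (inj_eq perm_inj).
Qed.

End Matchings.

Section Collision.
Variables (T : finType) (b : {perm T}) (x : T).
Hypothesis b_fix : forall y, b y != y.
Implicit Types (a : {perm T}).

Definition walk a k : T := iter k (a * b)%g x.

(** Collisions are with whole b-orbits rather than vertices, so that without them each step of the
    walk enters a fresh orbit. *)
Definition collides a k : bool :=
  [exists i : 'I_k.+1, a (walk a k) \in porbit b (walk a i)].

Lemma collidesPn a k i : ~~ collides a k -> i <= k ->
  a (walk a k) \notin porbit b (walk a i).
Proof.
rewrite -ltnS => + ik; apply: contraNN => h.
by apply/existsP; exists (Ordinal ik).
Qed.

Lemma walkS a k : walk a k.+1 = b (a (walk a k)).
Proof. by rewrite /walk iterS permM. Qed.

(** The vertex [walk a j.+1] shares its b-orbit with [a (walk a j)], so it is the absence of a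
    collision at time j that separates it from the past. *)
Lemma walk_disjoint a k i j : (forall l, l < k -> ~~ collides a l) ->
  i < j -> j <= k -> walk a j \notin porbit b (walk a i).
Proof.
move=> nc; case: j => // j ij jk; rewrite walkS porbit_stable.
exact: collidesPn (nc j jk) ij.
Qed.

(** The indices [i] and [e] express the collision vertex through the walk alone, which lets a
    rerouted matching be decoded. *)
Definition first_collision k i e : {set {perm T}} :=
  [set a in matchings T | [forall l : 'I_k, ~~ collides a l] &&
    (a (walk a k) == iter e b (walk a i))].

(** These are the vertices forbidden as a new partner of [walk a k]. The collision vertex
    [a (walk a k)] is not added by the second set, which stops before step [k]. *)
Definition visited a k : {set T} :=
  [set walk a (val l) | l : 'I_k.+1] :|: [set a (walk a (val l)) | l : 'I_k].

Lemma card_visited a k : #|visited a k| <= k.+1 + k.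
Proof.
apply: leq_trans (leq_card_setU _ _) _; apply: leq_add.
  by rewrite -[X in _ <= X]card_ord leq_imset_card.
by rewrite -[X in _ <= X]card_ord leq_imset_card.
Qed.

(* The edge realising the first collision cannot have been traversed before, so
   rerouting it does not change the walk up to that point. *)
Lemma walk_switch a k i e z : a \in first_collision k i e ->
  z \notin visited a k -> let a' := (a ^ tperm (a (walk a k)) z)%g in
  (forall l, l <= k -> walk a' l = walk a l) /\ a' (walk a k) = z.
Proof.
rewrite inE => /and3P[/matchingP aP /forallP nc0 _] zF /=.
have nc l : l < k -> ~~ collides a l by move=> lk; exact: (nc0 (Ordinal lk)).
set g := a (walk a k); set a' := (a ^ _)%g.
have zw l : l <= k -> walk a l != z.
  rewrite -ltnS => lk; apply: contraNneq zF => <-; rewrite inE; apply/orP; left.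
  by apply/imsetP; exists (Ordinal lk).
have zaw l : l < k -> a (walk a l) != z.
  move=> lk; apply: contraNneq zF => <-; rewrite inE; apply/orP; right.
  by apply/imsetP; exists (Ordinal lk).
have wne l : l < k -> walk a l != walk a k.
  move=> lk; apply: contraNneq (walk_disjoint nc lk (leqnn k)) => <-.
  exact: porbit_id.
have awg l : l < k -> a (walk a l) != g by move=> lk; rewrite (inj_eq perm_inj) wne.
(* If [walk a l = g], then [b (walk a k) = walk a l.+1]: this is a fixed point of [b] when l + 1 =
   k, and otherwise puts [walk a k] in an earlier b-orbit. *)
have wg l : l < k -> walk a l != g.
  move=> lk; apply/eqP=> wl.
  have awl : a (walk a l) = walk a k by rewrite wl /g; case: (aP (walk a k)).
  have bwk : b (walk a k) = walk a l.+1 by rewrite walkS awl.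
  have [kl|ltlk] := leqP k l.+1.
    have ek : l.+1 = k by lia.
    by have := b_fix (walk a k); rewrite bwk ek eqxx.
  have := walk_disjoint nc ltlk (leqnn k).
  by rewrite -porbit_stable bwk porbit_id.
have a'w l : l < k -> a' (walk a l) = a (walk a l).
  move=> lk; rewrite /a' permJ_tperm.
  by rewrite !tpermD // eq_sym ?wg ?awg ?zw ?zaw // ltnW.
have wa' l : l <= k -> walk a' l = walk a l.
  elim: l => // l IH lk; rewrite !walkS IH ?a'w //; exact: ltnW.
split=> //; rewrite /a' permJ_tperm (@tpermD _ g z (walk a k)) ?tpermL //.
  by case: (aP (walk a k)).
by rewrite eq_sym zw.
Qed.

(** Swapping the collision vertex with any [z] outside [visited] is injective on pairs (a, z). The
    walk up to time [k] survives, so [z] is read off as the new partner of its endpoint; the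
    collision vertex is then known and the conjugation can be undone. *)
Lemma card_first_collision k i e : i <= k ->
  #|first_collision k i e| * (#|T| - (k.+1 + k)) <= #|matchings T|.
Proof.
move=> ik; rewrite -sum_nat_const.
apply: (@leq_trans (\sum_(a in first_collision k i e) #|~: visited a k|)).
  apply: leq_sum => a _; rewrite -[X in _ <= X](addKn #|visited a k|) cardsC.
  by rewrite leq_sub2l // card_visited.
rewrite -card_setX_dep.
pose f (p : {perm T} * T) := (p.1 ^ tperm (iter e b (walk p.1 i)) p.2)%g.
set P := [set _ | _]; rewrite -(@card_in_imset _ _ f P).
  apply: subset_leq_card; apply/subsetP=> _ /imsetP[[a z] + ->].
  by rewrite inE /= => /andP[/setIdP[aM _] _]; apply: matchingJ.
move=> [a z] [a1 z1]; rewrite inE /= => /andP[aC +].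
rewrite inE /= => zF; rewrite inE /= => /andP[aC1 +].
rewrite inE /= => zF1; rewrite /f /=.
have [] := walk_switch aC zF; have [] := walk_switch aC1 zF1.
case/setIdP: aC => _ /andP[_ /eqP->]; case/setIdP: aC1 => _ /andP[_ /eqP->].
set c := (a ^ _)%g; set c1 := (a1 ^ _)%g => W1 Z1 W Z E.
have wk : walk a k = walk a1 k by rewrite -W // -W1 // E.
have wi : walk a i = walk a1 i by rewrite -W // -W1 // E.
have zz : z = z1 by rewrite -Z -Z1 wk E.
by move: E; rewrite /c /c1 wi zz => /conjg_inj ->.
Qed.

Hypothesis b3 : forall y, #|porbit b y| = 3.

(** Taking the least collision time yields a triple (k, i, e) with k, i < K and e < 3, hence the
    factor 3 K^2 in the union bound. *)
Lemma card_collides K :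
  #|[set a in matchings T | [exists k : 'I_K, collides a k]]| * (#|T| - K.*2)
    <= 3 * K ^ 2 * #|matchings T|.
Proof.
set E := [set a in _ | _].
have sub : E \subset \bigcup_(p : 'I_K * 'I_K * 'I_3 | p.1.2 <= p.1.1)
                       first_collision p.1.1 p.1.2 p.2.
  apply/subsetP=> a; rewrite inE => /andP[aM /existsP[k0 hk0]].
  have ex : exists k, collides a k by exists k0.
  case: (ex_minnP ex) => k hk kmin.
  have kK : k < K by apply: leq_ltn_trans (kmin _ hk0) (ltn_ord k0).
  case/existsP: (hk) => i; rewrite porbit_traject b3 => /trajectP[e e3 he].
  have iK : i < K by apply: leq_ltn_trans kK; rewrite -ltnS.
  apply/bigcupP; exists (Ordinal kK, Ordinal iK, Ordinal e3); first by rewrite /= -ltnS.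
  rewrite inE aM he eqxx andbT /=; apply/forallP=> l; apply/negP=> /kmin.
  by rewrite leqNgt ltn_ord.
apply: leq_trans (leq_mul (leq_trans (subset_leq_card sub) (leq_card_bigcup _ _)) (leqnn _)) _.
rewrite big_distrl /=.
apply: (@leq_trans (\sum_(p : 'I_K * 'I_K * 'I_3) #|matchings T|)).
  rewrite big_mkcond; apply: leq_sum => -[[k i] e] _; case: ifP => //= ik.
  apply: leq_trans (card_first_collision e ik); apply: leq_mul => //.
  by apply: leq_sub2l; rewrite -addnn addSn -addnS leq_add // ltnW.
by rewrite sum_nat_const !card_prod !card_ord -mulnn mulnC [3 * _]mulnC mulnC.
Qed.
End Collision.

(** * Planting cycles *)

Section ProdTperm.
Variables (T I : finType) (w u : I -> T).
Hypotheses (w_inj : injective w) (u_inj : injective u).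
Hypothesis wu : forall i j, w i != u j.

Lemma prod_tperm_out (r : seq I) y :
  (forall i, i \in r -> y != w i /\ y != u i) ->
  (\prod_(i <- r) tperm (w i) (u i))%g y = y.
Proof.
elim: r => [|i r IH] yr; first by rewrite big_nil perm1.
have [yw yu] := yr i (mem_head _ _).
rewrite big_cons permM tpermD 1?eq_sym // IH // => j jr.
by apply: yr; rewrite inE jr orbT.
Qed.

(** The transpositions are pairwise disjoint by [w_inj], [u_inj] and [wu], so only the [i]-th one
    moves [w i] and [u i]. *)
Lemma prod_tperm_in (r : seq I) i : uniq r -> i \in r ->
  (\prod_(i <- r) tperm (w i) (u i))%g (w i) = u i /\
  (\prod_(i <- r) tperm (w i) (u i))%g (u i) = w i.
Proof.
elim: r => // j r IH /= /andP[jr ur]; rewrite inE big_cons !permM.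
have [-> _|ij /= ir] := eqVneq i j.
  by rewrite tpermL tpermR !prod_tperm_out // => k kr;
     split; rewrite ?wu 1?eq_sym ?wu // ?(inj_eq w_inj) ?(inj_eq u_inj);
     apply: contraNneq jr => <-.
rewrite !tpermD ?(inj_eq w_inj) ?(inj_eq u_inj) ?wu 1?eq_sym ?wu //; exact: IH.
Qed.

End ProdTperm.

Lemma porbit3 (T : finType) (b : {perm T}) y : #|porbit b y| = 3 ->
  [/\ b y != y, b (b y) != y & b (b (b y)) = y].
Proof.
move=> b3; have := uniq_traject_porbit b y; have := iter_porbit b y; rewrite b3 /=.
by move=> ->; rewrite !inE negb_or => /andP[/andP[h1 h2] _]; rewrite ![_ == y]eq_sym.
Qed.

Section Planting.
Variables (T : finType) (b : {perm T}).
Hypothesis b3 : forall y, #|porbit b y| = 3.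
Variables (I : finType) (tau : I -> I) (N : nat).
Hypothesis tau_inj : injective tau.
Implicit Types (a : {perm T}) (v u : {ffun I -> T}) (y : T).

(** This is the region that the other chosen vertices must avoid. It starts from the whole triangle
    of [y], because rewiring also touches vertices [w i] lying in the triangles of chosen
    vertices. *)
Definition near a y : {set T} :=
  porbit b y :|: \bigcup_(x in porbit b y) \bigcup_(d < N.+1) porbit b (a (walk b x a d)).

Definition good a v : bool :=
  [forall i, forall j, (i != j) ==> (v j \notin near a (v i))] &&
  [forall i, forall x in porbit b (v i), forall k : 'I_N.+1, ~~ collides b x a k].

(* For u = a o v and w_i = b^-1 v_(tau i), conjugating a by [rewire v u] replaces
   the a-edges {v_i, a v_i} and {w_i, a w_i} by {v_i, w_i} and {a v_i, a w_i}, so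
   that afterwards v_i is sent to v_(tau i) by a * b. *)
Definition rewire v u : {perm T} := (\prod_i tperm ((b^-1)%g (v (tau i))) (u i))%g.

Lemma good_disjoint a v i j : good a v -> i != j -> v j \notin porbit b (v i).
Proof.
move=> /andP[/forallP/(_ i)/forallP/(_ j)/implyP h _] /h.
by rewrite inE negb_or => /andP[].
Qed.

(** For i <> j this is avoidance of [near]; for i = j it is the absence of a collision with the
    starting point of the walk, whose triangle is that of [v i]. *)
Lemma good_walk a v i j x d : good a v -> x \in porbit b (v i) -> d <= N ->
  a (walk b x a d) \notin porbit b (v j).
Proof.
move=> /andP[h1 h2] xi; rewrite -ltnS => dN; have [ij|ij] := eqVneq i j.
  move/forallP: h2 => /(_ i)/forall_inP/(_ x xi)/forallP/(_ (Ordinal dN)) /= nc.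
  have := collidesPn nc (leq0n _); rewrite -ij.
  by move: xi; rewrite -eq_porbit_mem => /eqP <-.
move/forallP: h1 => /(_ i)/forallP/(_ j)/implyP/(_ ij).
apply: contra => h; rewrite inE; apply/orP; right.
apply/bigcupP; exists x => //; apply/bigcupP; exists (Ordinal dN) => //.
by rewrite porbit_sym.
Qed.

Definition is_short a x := 2 <= #|porbit (a * b)%g x| <= N.

Section Planted.
Variables (a : {perm T}) (v : {ffun I -> T}).
Hypotheses (aM : a \in matchings T) (av : good a v).
Let u := [ffun i => a (v i)].
Let w i := (b^-1)%g (v (tau i)).
Let rho := rewire v u.
Let a' := (a ^ rho)%g.

Lemma good_inj : injective v.
Proof.
move=> i j vij; apply/eqP; apply: contraT => /(good_disjoint av).
by rewrite vij porbit_id.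
Qed.

Let wporb i : w i \in porbit b (v (tau i)).
Proof. by rewrite -porbit_stable permKV porbit_id. Qed.

Let w_inj : injective w.
Proof. by move=> i j /perm_inj/good_inj/tau_inj. Qed.

Let u_inj : injective u.
Proof. by move=> i j; rewrite !ffunE => /perm_inj/good_inj. Qed.

Let aK x : a (a x) = x. Proof. by case/matchingP/(_ x): aM. Qed.

Let avN i j : a (v i) \notin porbit b (v j).
Proof. exact: (good_walk (d := 0) j av (porbit_id _ _) isT). Qed.

Let awN i j : a (w i) \notin porbit b (v j).
Proof. exact: (good_walk (d := 0) j av (wporb i) isT). Qed.

Let wu i j : w i != u j.
Proof. by rewrite ffunE; apply: contraNneq (avN j (tau i)) => <-. Qed.

Let wv i j : w i != v j.
Proof.
apply/eqP=> wij; have := wporb i; rewrite wij porbit_sym => h.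
have [eij|/(good_disjoint av)] := eqVneq j (tau i); last by rewrite h.
by have [] := porbit3 (b3 (v j)); rewrite -{1}wij permKV -eij eqxx.
Qed.

Let vu i j : v i != u j.
Proof. by rewrite ffunE; apply: contraNneq (avN j i) => <-; apply: porbit_id. Qed.

Let rho_w i : rho (w i) = u i.
Proof.
exact: (proj1 (prod_tperm_in w_inj u_inj wu (index_enum_uniq I) (mem_index_enum i))).
Qed.

Let rho_u i : rho (u i) = w i.
Proof.
exact: (proj2 (prod_tperm_in w_inj u_inj wu (index_enum_uniq I) (mem_index_enum i))).
Qed.

Let rho_id y : (forall i, y != w i /\ y != u i) -> rho y = y.
Proof. by move=> h; apply: (@prod_tperm_out _ _ w u) => i _. Qed.

Let rho_v i : rho (v i) = v i.
Proof. by apply: rho_id => j; rewrite vu eq_sym wv. Qed.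

Let rho_aw i : rho (a (w i)) = a (w i).
Proof.
apply: rho_id => j; split.
  by apply: contraNneq (awN i (tau j)) => ->.
by rewrite ffunE (inj_eq perm_inj) wv.
Qed.

Lemma planted_step i : (a' * b)%g (v i) = v (tau i).
Proof. by rewrite permM -[v i]rho_v permJ -(ffunE (fun i => a (v i))) rho_u permKV. Qed.

Let special y := [exists i, [|| y == w i, y == u i | y == a (w i)]].

(** Leaving a touched vertex under the rewired matching amounts to starting an ab-walk of the old
    matching in the triangle of a chosen vertex: [w i] leads to [b (v i)], while [u i] and [a (w i)]
    continue as if one had left [w i] and [v i] in the old matching. *)
Let step_special x : special x -> exists j y e,
  [/\ y \in porbit b (v j), (a' * b)%g x = walk b y a e, e <= 1
    & e = 0 -> y = b (v j)].
Proof.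
case/existsP=> i /or3P[]/eqP->; rewrite permM.
- exists i, (b (v i)), 0; split=> //; first by rewrite porbit_stable porbit_id.
  by rewrite -rho_u permJ ffunE aK rho_v.
- exists (tau i), (w i), 1; split=> //.
  by rewrite walkS -rho_w permJ rho_aw.
- exists i, (v i), 1; split=> //; first exact: porbit_id.
  by rewrite walkS -[a (w i)]rho_aw permJ aK rho_w ffunE.
Qed.

Let step_plain x : ~~ special x -> (forall i, x != v i) ->
  (a' * b)%g x = (a * b)%g x.
Proof.
move=> /existsPn sx xv; rewrite [LHS]permM [RHS]permM.
have {}sx i : [/\ x != w i, x != u i & x != a (w i)].
  by have := sx i; rewrite !negb_or => /and3P[].
have rx : rho x = x by apply: rho_id => i; case: (sx i).
congr (b _); rewrite -{1}rx permJ; apply: rho_id => i.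
case: (sx i) => _ _ xaw; rewrite ffunE (inj_eq perm_inj) xv; split=> //.
by apply: contraNneq xaw => <-; rewrite aK.
Qed.

Lemma planted_iter i k : exists j, iter k (a' * b)%g (v i) = v j.
Proof.
elim: k => [|k [j IH]]; first by exists i.
by exists (tau j); rewrite iterS IH planted_step.
Qed.

(** A short cycle that is not planted must meet a touched vertex, since otherwise it existed before.
    Between consecutive visits to touched vertices it follows an old ab-walk of bounded length from
    one chosen triangle to another, which [good] excludes. *)
Lemma planted_short x : (forall y, ~~ is_short a y) -> is_short a' x ->
  exists i, x = v i.
Proof.
move=> nshort sx.
suff /existsP[i /eqP->] : [exists i, x == v i] by exists i.
apply: contraT => /existsPn xv.
(* The chosen vertices are closed under [a' * b], so a cycle through one of them contains nothing
   else. *)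
have nv k i : iter k (a' * b)%g x != v i.
  apply/eqP=> ki; have : x \in porbit (a' * b)%g (v i).
    by rewrite -ki -permX porbit_perm porbit_id.
  case/porbitP=> l; rewrite permX => xl; have [j lj] := planted_iter i l.
  by have := xv j; rewrite xl lj eqxx.
have [/existsP[k0 sk0]|/existsPn ns] :=
  boolP [exists k : 'I_#|porbit (a' * b)%g x|, special (iter k (a' * b)%g x)];
  last first.
  have ek k : iter k (a' * b)%g x = iter k (a * b)%g x.
    elim: k => // k IH; rewrite !iterS -IH step_plain //.
    have : iter k (a' * b)%g x \in porbit (a' * b)%g x by rewrite -permX mem_porbit.
    by rewrite porbit_traject => /trajectP[l lm ->]; apply: (ns (Ordinal lm)).
  have /porbit_setP e : porbit (a * b)%g x =i porbit (a' * b)%g x.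
    move=> y; apply/porbitP/porbitP => -[k ->]; exists k; by rewrite !permX ek.
  by move: sx; rewrite /is_short -e -/(is_short a x) (negbTE (nshort x)).
set z := iter k0 _ x in sk0.
have zx : porbit (a' * b)%g z = porbit (a' * b)%g x by rewrite /z -permX porbit_perm.
have nvz k i : iter k (a' * b)%g z != v i by rewrite /z -iterD.
have [m /andP[m1 mN] zm] : exists2 m, 0 < m <= N & iter m (a' * b)%g z = z.
  move: sx; rewrite /is_short -zx => /andP[h1 h2].
  by exists #|porbit (a' * b)%g z|; [rewrite (ltnW h1)|rewrite iter_porbit].
have ex : exists k, special (iter k.+1 (a' * b)%g z).
  by exists m.-1; rewrite prednK // zm.
(* The first return to a touched vertex occurs after [k.+1] steps; as [z] itself is touched, this is
   at most the cycle length. *)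
case: (ex_minnP ex) => k sk kmin.
have kN : k < N.
  apply: leq_trans mN; rewrite -ltnS -[m]prednK // !ltnS kmin // prednK //.
  by rewrite zm.
have [j [y [e [yj zy e1 e0]]]] := step_special sk0.
have zk l : l <= k -> iter l.+1 (a' * b)%g z = walk b y a (e + l).
  elim: l => [_|l IH lk]; first by rewrite addn0.
  rewrite iterS IH 1?ltnW // addnS walkS -permM -IH 1?ltnW // step_plain //.
  by apply: contraL lk => /kmin; rewrite -leqNgt.
move: sk; rewrite zk // => /existsP[i /or3P[]/eqP te].
(* Each kind of touched vertex forces an a-edge from the walk into a chosen triangle, against
   [good_walk]. The exception is a walk of length 0 ending at [w i]: then [b (b (v j)) = v (tau i)],
   which contradicts either [good_disjoint] or the order of [b]. *)
- case ed: (e + k) te => [|d].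
    have /eqP := ed; rewrite addn_eq0 => /andP[/eqP/e0 yb _] te.
    have {te} bbv : b (b (v j)) = v (tau i).
      by move: te; rewrite /walk /= yb => ->; rewrite permKV.
    have [jt|/(good_disjoint av)] := eqVneq j (tau i).
      by have [_ + _] := porbit3 (b3 (v j)); rewrite bbv jt eqxx.
    by rewrite -bbv !porbit_stable porbit_id.
  move=> te; have dN : d <= N by lia.
  have := good_walk (tau i) av yj dN.
  by rewrite -porbit_stable -walkS te wporb.
- have dN : e + k <= N by lia.
  by have := good_walk i av yj dN; rewrite te ffunE aK porbit_id.
- have dN : e + k <= N by lia.
  by have := good_walk (tau i) av yj dN; rewrite te aK wporb.
Qed.
End Planted.
End Planting.

(** * Counting rewirings and bad choices of vertices *)

Section PlantingCount.
Variables (T : finType) (b : {perm T}).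
Hypothesis b3 : forall y, #|porbit b y| = 3.
Variables (I : finType) (tau : I -> I) (N : nat).
Hypothesis tau_inj : injective tau.
Implicit Types (a : {perm T}) (v u : {ffun I -> T}) (y : T).

(** The last condition makes the planted cycles account for all short cycles, so that their lengths
    can be read off [a]. *)
Definition planted a : {set {ffun I -> T}} :=
  [set v : {ffun I -> T} | [&& injectiveb v,
     [forall i, (a * b)%g (v i) == v (tau i)] &
     [forall x, is_short b N a x ==> [exists i, x == v i]]]].

Definition no_short : {set {perm T}} :=
  [set a in matchings T | [forall x, ~~ is_short b N a x]].

(** A good pair is mapped to the rewired matching together with [v] and the old neighbours u = a o
    v. From [v] and [u] the conjugation can be undone; remembering [u] costs the factor |T|^|I|. *)
Lemma card_good_pairs :
  #|[set p : {perm T} * {ffun I -> T} | (p.1 \in no_short) && good b N p.1 p.2]| <=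
  (\sum_(a in matchings T) #|planted a|) * #|T| ^ #|I|.
Proof.
pose img v a := [ffun i => a (v i)] : {ffun I -> T}.
pose f (p : {perm T} * {ffun I -> T}) :=
  ((p.1 ^ rewire b tau p.2 (img p.2 p.1))%g, p.2, img p.2 p.1).
have f_inj : injective f.
  by move=> [a v] [a' v'] [+ e2 e3]; rewrite e3 e2 => /conjg_inj ->.
rewrite -(card_imset _ f_inj) -card_setX_dep -card_ffun -[X in _ * X]cardsT -cardsX.
apply: subset_leq_card; apply/subsetP=> _ /imsetP[[a v] + ->].
rewrite inE /= => /andP[/setIdP[aM /forallP ns] av].
rewrite !in_setX in_setT andbT in_set /= matchingJ //= in_set.
apply/and3P; split.
- by apply/injectiveP; apply: good_inj av.
- apply/forallP=> i; apply/eqP. exact: (planted_step b3 tau_inj av).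
- apply/forallP=> x; apply/implyP=> sx; apply/existsP.
  by have [i ->] := planted_short b3 tau_inj aM av ns sx; exists i.
Qed.

Definition far_bad : {set {perm T} * {ffun I -> T}} :=
  [set p : {perm T} * {ffun I -> T} | (p.1 \in matchings T) &&
    [exists q : I * I, (q.1 != q.2) && (p.2 q.2 \in near b N p.1 (p.2 q.1))]].

Definition self_bad : {set {perm T} * {ffun I -> T}} :=
  [set p : {perm T} * {ffun I -> T} | (p.1 \in matchings T) &&
    [exists i, exists x in porbit b (p.2 i), exists k : 'I_N.+1, collides b x p.1 k]].

(** The count is 3 for the triangle of [y], plus 3 starting points times N + 1 walk lengths times 3
    vertices. *)
Lemma card_near a y : #|near b N a y| <= 9 * N + 12.
Proof.
apply: leq_trans (leq_card_setU _ _) _; rewrite b3.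
apply: (@leq_trans (3 + \sum_(x in porbit b y) \sum_(d < N.+1) 3)).
  rewrite leq_add2l; apply: leq_trans (leq_card_bigcup _ _) _.
  apply: leq_sum => x _; apply: leq_trans (leq_card_bigcup _ _) _.
  by apply: leq_sum => d _; rewrite b3.
by rewrite !sum_nat_const b3 card_ord; lia.
Qed.

Lemma card_far_bad :
  #|far_bad| * #|T| <= #|I| ^ 2 * (9 * N + 12) * (#|matchings T| * #|T| ^ #|I|).
Proof.
have -> : far_bad = [set p : {perm T} * {ffun I -> T} | (p.1 \in matchings T) && (p.2 \in
   \bigcup_(q : I * I | q.1 != q.2) [set v : {ffun I -> T} | v q.2 \in near b N p.1 (v q.1)])].
  apply/setP=> -[a v]; rewrite [LHS]in_set [RHS]in_set /=; congr (_ && _).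
  apply/existsP/bigcupP => [[q /andP[h1 h2]]|[q h1]].
    by exists q => //; rewrite in_set.
  by rewrite in_set => h2; exists q; rewrite h1.
rewrite (card_setX_dep (matchings T) (fun a => \bigcup_(q : I * I | q.1 != q.2)
   [set v : {ffun I -> T} | v q.2 \in near b N a (v q.1)])).
rewrite mulnCA -sum_nat_const big_distrl; apply: leq_sum => a _ /=.
apply: leq_trans (leq_mul (leq_card_bigcup _ _) (leqnn _)) _.
rewrite big_distrl /= -mulnA -mulnn -card_prod -sum_nat_const big_mkcond.
apply: leq_sum => q _; case: ifP => // qq.
by apply: card_ffun_rel => // y; apply: card_near.
Qed.

(** Here [v] is fixed and [a] varies: [card_collides] with K = N + 1 is applied to each of the 3 |I|
    starting points. *)
Lemma card_self_bad :
  #|self_bad| * (#|T| - N.+1.*2) <=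
  #|I| * 3 * (3 * N.+1 ^ 2) * (#|matchings T| * #|T| ^ #|I|).
Proof.
rewrite (card_pair_swap (fun a v => (a \in matchings T) &&
  [exists i, exists x in porbit b (v i), exists k : 'I_N.+1, collides b x a k])).
rewrite [X in _ <= _ * X]mulnC mulnCA -card_ffun -sum_nat_const big_distrl.
apply: leq_sum => v _ /=.
set E := [set _ | _].
have : #|E| <= \sum_i \sum_(x in porbit b (v i))
    #|[set a in matchings T | [exists k : 'I_N.+1, collides b x a k]]|.
  apply: (@leq_trans #|\bigcup_i \bigcup_(x in porbit b (v i))
    [set a in matchings T | [exists k : 'I_N.+1, collides b x a k]]|).
    apply: subset_leq_card; apply/subsetP=> a; rewrite in_set.
    case/andP=> aM /existsP[i /exists_inP[x xi ex]].
    by apply/bigcupP; exists i => //; apply/bigcupP; exists x => //; rewrite in_set aM.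
  apply: leq_trans (leq_card_bigcup _ _) _; apply: leq_sum => i _.
  exact: leq_card_bigcup.
move=> h; apply: leq_trans (leq_mul h (leqnn _)) _.
rewrite -!mulnA -sum_nat_const big_distrl; apply: leq_sum => i _ /=.
rewrite -[X in _ <= X * _](b3 (v i)) -sum_nat_const big_distrl; apply: leq_sum => x _ /=.
have b_fix y : b y != y by case: (porbit3 (b3 y)).
by have := card_collides x b_fix b3 N.+1; rewrite -mulnn -!mulnA.
Qed.

Lemma card_no_short :
  #|no_short| * #|T| ^ #|I| <=
  (\sum_(a in matchings T) #|planted a|) * #|T| ^ #|I| + #|far_bad| + #|self_bad|.
Proof.
rewrite -addnA -card_ffun -[X in _ * X]cardsT -cardsX.
set G := setX _ _.
have sub : G \subset [set p : {perm T} * {ffun I -> T} |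
                       (p.1 \in no_short) && good b N p.1 p.2] :|:
                     (far_bad :|: self_bad).
  apply/subsetP=> -[a v]; rewrite in_setX in_setT andbT /= => ans.
  have aM : a \in matchings T by case/setIdP: ans.
  rewrite in_setU inE /= ans /=; case: (boolP (good b N a v)) => //=.
  rewrite negb_and inE => /orP[/forallPn[i /forallPn[j]]|/forallPn[i]].
    rewrite negb_imply negbK => h; apply/orP; left.
    by rewrite inE /= aM; apply/existsP; exists (i, j).
  rewrite negb_forall_in => /exists_inP[x xi] /forallPn[k]; rewrite negbK => h.
  apply/orP; right; rewrite inE /= aM; apply/existsP; exists i.
  by apply/exists_inP; exists x => //; apply/existsP; exists k.
apply: leq_trans (subset_leq_card sub) _.
apply: leq_trans (leq_card_setU _ _) _; apply: leq_add.
  by rewrite card_ffun card_good_pairs.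
exact: leq_card_setU.
Qed.

End PlantingCount.

(** * Families of cycles with prescribed lengths *)

Section CycleType.
Variables (N : nat).
Implicit Types (L : {set 'I_N.+1}).

(** Length 0 outside [L] leaves the fibres over absent lengths empty. *)
Definition cycle_len L (m : 'I_N.+1) : nat := if m \in L then nat_of_ord m else 0.

(* Positions of a disjoint union of cycles, one of each length in L. *)
Definition cycle_index L : finType := {m : 'I_N.+1 & 'I_(cycle_len L m)}.

Definition cycle_succ L (i : cycle_index L) : cycle_index L :=
  Tagged (fun m => 'I_(cycle_len L m)) (ordS (tagged i)).

Lemma cycle_succ_inj L : injective (@cycle_succ L).
Proof.
move=> [m i] [m' j] e.
have em : m = m' by apply: (congr1 tag e).
case: m' / em j e => j /eqP; rewrite -tag_eqE /tag_eq eqxx /= tagged_asE.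
by move/eqP/ordS_inj => ->.
Qed.

Lemma card_cycle_index L : #|cycle_index L| <= N * N.+1.
Proof.
rewrite card_tagged sumnE big_map big_enum /=.
apply: (@leq_trans (\sum_(m < N.+1) N)); last by rewrite sum_nat_const card_ord mulnC.
apply: leq_sum => m _; rewrite card_ord /cycle_len; case: ifP => // _.
by rewrite -ltnS.
Qed.

Lemma cycle_index_len L (i : cycle_index L) : cycle_len L (tag i) = tag i /\ tag i \in L.
Proof.
case: i => m j /=; rewrite /cycle_len; case: ifP => // mL.
by case: j => j; rewrite /cycle_len mL.
Qed.

Lemma iter_cycle_succ L m (j : 'I_(cycle_len L m)) k :
  exists j' : 'I_(cycle_len L m), j' = ((j + k) %% cycle_len L m) :> nat /\
    iter k (@cycle_succ L) (Tagged (fun m => 'I_(cycle_len L m)) j) =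
    Tagged (fun m => 'I_(cycle_len L m)) j'.
Proof.
elim: k => [|k [j' [e IH]]]; first by exists j; rewrite addn0 modn_small.
exists (ordS j'); split; last by rewrite iterS IH.
by rewrite /= e addnS -addn1 modnDml addn1.
Qed.

End CycleType.

Section PlantedCycles.
Variables (T : finType) (x0 : T) (b : {perm T}) (N : nat).
Implicit Types (L : {set 'I_N.+1}) (a : {perm T}).

Definition plantedL L a := planted b (@cycle_succ N L) N a.

Lemma plantedP L a (v : {ffun cycle_index L -> T}) : v \in plantedL L a ->
  [/\ injective v, forall i, (a * b)%g (v i) = v (cycle_succ i)
    & forall x, is_short b N a x -> exists i, x = v i].
Proof.
rewrite inE => /and3P[/injectiveP vi /forallP vs /forallP vx]; split=> // [i|x sx].
  exact/eqP.
by have /implyP/(_ sx)/existsP[i /eqP->] := vx x; exists i.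
Qed.

Lemma planted_iterE L a (v : {ffun cycle_index L -> T}) i k : v \in plantedL L a ->
  iter k (a * b)%g (v i) = v (iter k (@cycle_succ N L) i).
Proof.
move=> /plantedP[_ vs _]; elim: k => // k IH; by rewrite !iterS IH vs.
Qed.

Lemma card_porbit_planted L a (v : {ffun cycle_index L -> T}) i : v \in plantedL L a ->
  #|porbit (a * b)%g (v i)| = tag i.
Proof.
move=> va; have [vi vs _] := plantedP va; have [<- _] := cycle_index_len i.
case: i => m j /=.
pose f j := v (Tagged (fun m => 'I_(cycle_len L m)) (j : 'I_(cycle_len L m))).
have f_inj : injective f.
  move=> j1 j2 /vi /eqP; rewrite -tag_eqE /tag_eq eqxx /= tagged_asE.
  by move/eqP.
rewrite -[RHS]card_ord -(card_imset _ f_inj).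
suff -> : porbit (a * b)%g (v (existT _ m j)) = f @: 'I_(cycle_len L m) by [].
apply/setP=> y; apply/porbitP/imsetP => [[k ->]|[j' _ ->]].
  rewrite permX planted_iterE //; have [j' [_ e]] := iter_cycle_succ j k.
  by exists j' => //; rewrite e.
(* Going from [j] to [j'] takes j' - j steps modulo the length; adding one full turn avoids a
   negative number. *)
exists (j' + (cycle_len L m - j)); rewrite permX planted_iterE //.
have [j1 [e ->]] := iter_cycle_succ j (j' + (cycle_len L m - j)).
congr (v (Tagged _ _)); apply/val_inj; rewrite /= e addnCA subnKC; last exact: ltnW.
by rewrite modnDr modn_small.
Qed.

(** Hence [L] is determined by [a]: each matching has planted families for at most one set of
    lengths. *)
Lemma planted_lengths L a (v : {ffun cycle_index L -> T}) :
  (forall m, m \in L -> 2 <= m) -> v \in plantedL L a ->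
  L = [set m : 'I_N.+1 | [exists x, is_short b N a x && (#|porbit (a * b)%g x| == m)]].
Proof.
move=> L2 va; have [vi vs vx] := plantedP va.
apply/setP=> m; rewrite inE; apply/idP/existsP => [mL|[x /andP[/vx[i ->]]]].
  have m0 : 0 < cycle_len L m by rewrite /cycle_len mL ltnW // L2.
  pose i := Tagged (fun m => 'I_(cycle_len L m)) (Ordinal m0) : cycle_index L.
  exists (v i); rewrite /is_short card_porbit_planted //= L2 // eqxx andbT /=.
  by rewrite -ltnS.
rewrite card_porbit_planted // => /eqP e; have [_] := cycle_index_len i.
by congr (_ \in L); apply/val_inj.
Qed.

(** A planted family is determined by one starting vertex per cycle. For length m there are m
    candidates, because the vertices on ab-cycles of length m form the single planted cycle of that
    length. *)
Lemma card_planted L a : (forall m, m \in L -> 2 <= m) ->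
  #|plantedL L a| <= \prod_(m in L) m.
Proof.
move=> L2; have [->|[v0 v0a]] := set_0Vmem (plantedL L a).
  by rewrite cards0.
pose D (m : 'I_N.+1) := [pred x | #|porbit (a * b)%g x| == m].
have cD m : m \in L -> #|D m| = m.
  move=> mL; have m0 : 0 < cycle_len L m by rewrite /cycle_len mL ltnW // L2.
  rewrite -[RHS](card_porbit_planted (Tagged (fun m => 'I_(cycle_len L m)) (Ordinal m0)) v0a).
  apply: eq_card => x.
  rewrite inE; apply/eqP/idP => [cx|]; last first.
    by rewrite -eq_porbit_mem => /eqP->; apply: card_porbit_planted.
  have [_ _ v0x] := plantedP v0a.
  have sx : is_short b N a x by rewrite /is_short cx L2 // -ltnS /=.
  have [[m' j] xj] := v0x _ sx.
  have em : m' = m.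
    by apply/val_inj; rewrite /= -cx xj card_porbit_planted.
  case: m / em mL m0 cx => mL m0 cx.
  have [j' [e1 e2]] := iter_cycle_succ (Ordinal m0) j.
  apply/porbitP; exists j; rewrite permX planted_iterE // e2 xj.
  congr (v0 (Tagged _ _)); apply/val_inj; rewrite /= e1 add0n modn_small //.
(* [r v] records the vertex at position 0 of each cycle, with default [x0] at lengths outside [L],
   as [pfamily] requires. *)
pose r (v : {ffun cycle_index L -> T}) : {ffun 'I_N.+1 -> T} :=
  [ffun m : 'I_N.+1 => oapp (fun j : 'I_(cycle_len L m) =>
                               v (Tagged (fun m => 'I_(cycle_len L m)) j)) x0 (insub 0)].
have rE v m (m0 : 0 < cycle_len L m) :
    r v m = v (Tagged (fun m => 'I_(cycle_len L m)) (Ordinal m0)).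
  by rewrite ffunE insubT.
have -> : \prod_(m in L) m = #|pfamily x0 (mem L) D|.
  rewrite card_pfamily foldrE big_image /=; apply: eq_bigr => m mL.
  by rewrite cD.
rewrite -(@card_in_imset _ _ r (plantedL L a)).
  apply: subset_leq_card; apply/subsetP=> _ /imsetP[v va ->].
  apply/pfamilyP; split.
    apply/subsetP=> m; rewrite inE ffunE; apply: contraR => mL.
    by rewrite insubF //= /cycle_len (negbTE mL).
  move=> m mL; have m0 : 0 < cycle_len L m by rewrite /cycle_len mL ltnW // L2.
  by rewrite rE inE card_porbit_planted.
move=> v v' va va' rr; apply/ffunP=> -[m j].
have m0 : 0 < cycle_len L m by apply: leq_ltn_trans (ltn_ord j).
have [j' [e1 e2]] := iter_cycle_succ (Ordinal m0) j.
have jj : j = j' by apply/val_inj; rewrite /= e1 add0n modn_small.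
have E w : w \in plantedL L a -> w (existT _ m j) = iter j (a * b)%g (r w m).
  by move=> wa; rewrite rE planted_iterE // e2 -jj.
by rewrite !E // rr.
Qed.

End PlantedCycles.

(** * Connectedness *)

Section Binomials.

(** The left side is one term of Vandermonde's convolution. *)
Lemma leq_mul_bin m n i j : 'C(m, i) * 'C(n, j) <= 'C(m + n, i + j).
Proof.
have hi : i < (i + j).+1 by rewrite ltnS leq_addr.
by rewrite -binomial.Vandermonde (bigD1 (Ordinal hi)) //= addKn leq_addr.
Qed.

Lemma leq_bin_mid n t : 0 < t < n -> n <= 'C(n, t).
Proof.
elim: n t => [|n IH] [|t] // /andP[_ tn] //; rewrite ltnS in tn; rewrite binS.
have [<-|tne] := eqVneq t.+1 n; first by rewrite binn binSn.
have h : n <= 'C(n, t.+1) by apply: IH; rewrite /= ltn_neqAle tne.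
by rewrite -addn1 leq_add // bin_gt0 ltnW.
Qed.

End Binomials.

Section Stable.
Variable T : finType.
Implicit Types (a b : {perm T}) (S : {set T}).

Definition stable a S := [forall x, (a x \in S) == (x \in S)].

Lemma stableP a S : reflect (forall x, (a x \in S) = (x \in S)) (stable a S).
Proof. by apply: (iffP forallP) => h x; apply/eqP; rewrite h. Qed.

Lemma stableC a S : stable a S -> stable a (~: S).
Proof. by move=> /stableP aS; apply/stableP=> x; rewrite !inE aS. Qed.

Lemma stable_porbit a S x y : stable a S -> y \in porbit a x -> (y \in S) = (x \in S).
Proof.
move=> /stableP aS /porbitP[i ->]; rewrite permX.
by elim: i => //= i <-; rewrite aS.
Qed.

Lemma stableJ a t S : stable (a ^ t)%g (t @: S) = stable a S.
Proof.
apply/stableP/stableP => h x.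
  by have := h (t x); rewrite permJ !mem_imset //; apply: perm_inj.
have [y ->] : exists y, x = t y by exists ((t^-1)%g x); rewrite permKV.
by rewrite permJ !mem_imset //; apply: perm_inj.
Qed.

Section Uniform.
Variables (a : {perm T}) (k : nat).
Hypothesis ak : forall x, #|porbit a x| = k.

Lemma card_stable S : stable a S -> #|S| = #|porbit a @: S| * k.
Proof.
move=> aS; rewrite -sum1_card (partition_big_imset (porbit a)) /= -sum_nat_const.
apply: eq_bigr => _ /imsetP[x xS ->]; rewrite sum1dep_card -(ak x).
apply: eq_card => y; rewrite !inE eq_porbit_mem.
by case: (boolP (y \in porbit a x)) => yx; rewrite ?andbF // (stable_porbit aS yx) xS.
Qed.

(** A stable set is a union of orbits, hence is determined by which of the |T| / k orbits it
    contains. *)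
Lemma card_stable_sets t : 0 < k ->
  #|[set S : {set T} | stable a S && (#|S| == t * k)]| <= 'C(#|T| %/ k, t).
Proof.
move=> k0.
have cT : #|porbits a| = #|T| %/ k.
  have := @card_stable setT; rewrite cardsT => ->; last by apply/stableP=> x; rewrite !inE.
  rewrite mulnK //; congr #|pred_of_set _|; apply/setP=> c.
  by apply/imsetP/imsetP => -[x _ ->]; exists x.
rewrite -cT -cards_draws.
rewrite -(@card_in_imset _ _ (fun S : {set T} => porbit a @: S)).
  apply: subset_leq_card; apply/subsetP=> _ /imsetP[S + ->].
  rewrite inE => /andP[aS /eqP cS]; rewrite inE imsetS ?subset_predT //=.
  by rewrite -(eqn_pmul2r k0) -card_stable // cS.
move=> S S'; rewrite !inE => /andP[aS _] /andP[aS' _] e; apply/setP=> x.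
have E U : stable a U -> (x \in U) = (porbit a x \in porbit a @: U).
  move=> aU; apply/idP/imsetP => [xU|[y yU /eqP]]; first by exists x.
  by rewrite eq_porbit_mem => /(stable_porbit aU) ->.
by rewrite !E // e.
Qed.

End Uniform.

(** List each set followed by its complement; matching equal positions of the two lists gives the
    permutation. *)
Lemma perm_imset_eq S S' : #|S| = #|S'| -> exists t : {perm T}, t @: S = S'.
Proof.
move=> cS; pose e (U : {set T}) := enum U ++ enum (~: U).
have mem_e U x : x \in e U by rewrite mem_cat !mem_enum inE; case: (x \in U).
have uniq_e U : uniq (e U).
  rewrite cat_uniq !enum_uniq /= andbT; apply/hasPn=> x.
  by rewrite !mem_enum inE.
have size_e U : size (e U) = #|T| by rewrite size_cat -!cardE cardsC.
pose f x := nth x (e S') (index x (e S)).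
have ltx x : index x (e S) < size (e S') by rewrite size_e -(size_e S) index_mem.
have f_inj : injective f.
  move=> x y; rewrite /f (set_nth_default y) // => /eqP.
  rewrite nth_uniq // => /eqP ii; have := nth_index y (mem_e S x).
  by rewrite ii nth_index.
exists (perm f_inj); apply/eqP; rewrite eqEcard card_imset ?cS ?leqnn ?andbT;
  last exact: perm_inj.
apply/subsetP=> _ /imsetP[x xS ->]; rewrite permE /f.
rewrite nth_cat -cardE -cS cardE index_cat mem_enum xS index_mem mem_enum xS.
by rewrite -mem_enum mem_nth // -cardE -cS cardE index_mem mem_enum.
Qed.

Definition matchings_on S : {set {perm T}} := [set a in matchings T | stable a S].

Lemma card_matchings_on_eq S S' : #|S| = #|S'| -> #|matchings_on S| <= #|matchings_on S'|.
Proof.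
case/perm_imset_eq=> t <-; rewrite -(card_imset _ (@conjg_inj _ t)).
apply: subset_leq_card; apply/subsetP=> _ /imsetP[a + ->].
by case/setIdP=> aM aS; apply/setIdP; rewrite stableJ matchingJ.
Qed.

(** Double counting of pairs (a, S') with S' stable of size 2t: by conjugation every S' occurs
    equally often, and a matching stabilises at most C(|T| / 2, t) such sets. *)
Lemma card_matchings_on S t : #|S| = t * 2 ->
  #|matchings_on S| * 'C(#|T|, t * 2) <= #|matchings T| * 'C(#|T| %/ 2, t).
Proof.
move=> cS; rewrite -(card_draws T) mulnC -sum_nat_const.
apply: (@leq_trans (\sum_(S' : {set T} | #|S'| == t * 2) #|matchings_on S'|)).
  rewrite (eq_bigl (fun S' : {set T} => #|S'| == t * 2)); last by move=> S'; rewrite inE.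
  by apply: leq_sum => S' /eqP cS'; apply: card_matchings_on_eq; rewrite cS.
under eq_bigr => S' _ do rewrite -sum1dep_card.
rewrite (exchange_big_dep (mem (matchings T))) /=; last by move=> S' a _ /andP[].
rewrite -sum_nat_const; apply: leq_sum => a aM; rewrite sum1dep_card.
have ak x : #|porbit a x| = 2 by move: aM; rewrite inE => /forallP/(_ x)/eqP.
apply: leq_trans (card_stable_sets ak t isT); apply: subset_leq_card.
by apply/subsetP=> S'; rewrite !in_set => /and3P[-> _ ->].
Qed.

End Stable.

Section Connectivity.
Variables (T : finType) (b : {perm T}) (q : nat).
Hypotheses (b3 : forall y, #|porbit b y| = 3) (cT : #|T| = 6 * q).

Definition disconnected : {set {perm T}} := [set a in matchings T |
  [exists S : {set T}, [&& stable a S, stable b S, S != set0 & S != setT]]].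

(** There are at most C(2q, 2t) sets stable under [b], each with at most a fraction C(3q, 3t) /
    C(6q, 6t) of the matchings. Vandermonde gives C(3q, 3t)^2 <= C(6q, 6t) and C(2q, 2t) C(q, t) <=
    C(3q, 3t), leaving 1 / C(q, t) <= 1 / q. *)
Lemma card_disconnected_size t : 0 < t < q ->
  (\sum_(S : {set T} | stable b S && (#|S| == t * 2 * 3)) #|matchings_on S|) * q
    <= #|matchings T|.
Proof.
move=> tq; set X := \sum_(S | _) _.
have h1 : X * 'C(6 * q, t * 3 * 2) <=
    'C(2 * q, t * 2) * (#|matchings T| * 'C(3 * q, t * 3)).
  have -> : 2 * q = #|T| %/ 3 by rewrite cT -[6]/(3 * 2) -mulnA mulKn.
  rewrite /X big_distrl /=.
  apply: leq_trans (leq_mul (card_stable_sets b3 (t * 2) isT) (leqnn _)).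
  rewrite -sum_nat_const big_mkcond [X in _ <= X]big_mkcond; apply: leq_sum => S _.
  rewrite inE; case: ifP => // /andP[_ /eqP cS].
  have -> : 3 * q = #|T| %/ 2 by rewrite cT -[6]/(2 * 3) -mulnA mulKn.
  by rewrite -cT card_matchings_on // cS mulnAC.
have c3 : 0 < 'C(3 * q, t * 3) by rewrite bin_gt0; lia.
have h2 : 'C(3 * q, t * 3) * 'C(3 * q, t * 3) <= 'C(6 * q, t * 3 * 2).
  have -> : 6 * q = 3 * q + 3 * q by lia.
  by rewrite muln2 -addnn leq_mul_bin.
have h3 : 'C(2 * q, t * 2) * q <= 'C(3 * q, t * 3).
  have -> : 3 * q = 2 * q + q by lia.
  have -> : t * 3 = t * 2 + t by lia.
  by apply: leq_trans (leq_mul_bin _ _ _ _); rewrite leq_mul // leq_bin_mid.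
have c2 : 0 < 'C(2 * q, t * 2) by rewrite bin_gt0; lia.
have h4 : X * 'C(3 * q, t * 3) <= 'C(2 * q, t * 2) * #|matchings T|.
  rewrite -(leq_pmul2r c3) -mulnA -(mulnA 'C(2 * q, _)).
  by apply: leq_trans h1; rewrite leq_mul.
rewrite -(leq_pmul2l c2) mulnCA; apply: leq_trans h4.
by rewrite leq_mul.
Qed.

(** Up to complement an invariant set has at most 3q elements, and its size is divisible by both 2
    and 3. So there are at most q / 2 possible sizes, each contributing a fraction at most 1 / q. *)
Lemma card_disconnected : 0 < q -> 2 * #|disconnected| <= #|matchings T|.
Proof.
move=> q0.
have sub : disconnected \subset \bigcup_(t < q./2)
    \bigcup_(S : {set T} | stable b S && (#|S| == t.+1 * 2 * 3)) matchings_on S.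
  apply/subsetP=> a; rewrite in_set => /andP[aM /existsP[S0]].
  case/and4P=> aS0 bS0 S0n S0T.
  have [S [aS bS Sn cS]] : exists S : {set T},
      [/\ stable a S, stable b S, 0 < #|S| & #|S| <= 3 * q].
    have e := cardsC S0; have [h|h] := leqP #|S0| (3 * q).
      by exists S0; rewrite card_gt0.
    exists (~: S0); rewrite !stableC //; split=> //; last by rewrite cT in e; lia.
    rewrite card_gt0; apply: contra S0T => /eqP e0.
    by rewrite -[S0]setCK e0 setC0.
  have ak x : #|porbit a x| = 2 by move: aM; rewrite inE => /forallP/(_ x)/eqP.
  have c2 := card_stable ak aS; have c3 := card_stable b3 bS.
  (* The union is indexed by t - 1 where |S| = 6t, since t >= 1. *)
  have tq : (#|S| %/ 6).-1 < q./2 by lia.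
  apply/bigcupP; exists (Ordinal tq) => //=; apply/bigcupP; exists S.
    by rewrite bS /=; lia.
  by rewrite in_set aM.
have := leq_trans (subset_leq_card sub) (leq_card_bigcup _ _).
move=> h.
have {h} : #|disconnected| * q <= q./2 * #|matchings T|.
  apply: leq_trans (leq_mul h (leqnn q)) _.
  rewrite big_distrl /= -[X in _ <= X * _]card_ord -sum_nat_const.
  apply: leq_sum => t _; apply: leq_trans (card_disconnected_size (t := t.+1) _).
    by rewrite leq_mul2r leq_card_bigcup orbT.
  by have := ltn_ord t; lia.
have := leq_mul (leqnn #|matchings T|) (half_leq (leqnn q)); nia.
Qed.

End Connectivity.

(** * Existence of matchings and of permutations with all cycles of length 3 *)

Section Existence.

Lemma matchings_gt0 q : 0 < #|matchings 'I_(6 * q)|.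
Proof.
have f_lt (x : 'I_(6 * q)) : (if odd x then x.-1 else x.+1) < 6 * q.
  by case: ifP; have := ltn_ord x; lia.
pose f x := Ordinal (f_lt x).
have fK : cancel f f by move=> x; apply/val_inj => /=; do 2! case: ifP; lia.
rewrite card_gt0; apply/set0Pn; exists (perm (can_inj fK)).
apply/matchingP=> x; rewrite !permE fK; split=> //.
by apply/eqP=> /(congr1 val) /=; case: ifP; lia.
Qed.

Definition triangle_perms T : {set {perm T}} := [set b | [forall x, #|porbit b x| == 3]].

Lemma triangle_perms_gt0 q : 0 < #|triangle_perms 'I_(6 * q)|.
Proof.
have f_lt (x : 'I_(6 * q)) : (if x %% 3 == 2 then x - 2 else x.+1) < 6 * q.
  by case: ifP; have := ltn_ord x; lia.
pose f x := Ordinal (f_lt x).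
have f3 x : f (f (f x)) = x.
  by apply/val_inj => /=; do 3! case: ifP; lia.
have f_inj : injective f by move=> x y e; rewrite -(f3 x) e f3.
rewrite card_gt0; apply/set0Pn; exists (perm f_inj).
rewrite inE; apply/forallP=> x; set b := perm _.
have bE y : b y = f y by rewrite permE.
have b1 : b x != x by rewrite bE; apply/eqP=> /(congr1 val) /=; case: ifP; lia.
have b2 : b (b x) != x.
  by rewrite !bE; apply/eqP=> /(congr1 val) /=; do 2! case: ifP; lia.
have b3 : b (b (b x)) = x by rewrite !bE f3.
have e : porbit b x =i [:: x; b x; b (b x)].
  move=> y; rewrite !inE; apply/porbitP/or3P => [[i ->]|].
    rewrite permX; elim: i => [|i] /=; first by rewrite eqxx; constructor.
    by case=> /eqP->; rewrite ?b3 eqxx; [constructor 2|constructor 3|constructor 1].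
  by case=> /eqP->; [exists 0|exists 1|exists 2]; rewrite permX.
have u : uniq [:: x; b x; b (b x)].
  by rewrite /= !inE negb_or ![x == _]eq_sym b1 b2 (inj_eq perm_inj) eq_sym b1.
by rewrite (eq_card e) (card_uniqP u).
Qed.

End Existence.

Local Open Scope ring_scope.

(** * Summation over the sets of lengths *)

Section Weights.
Variables (R : realFieldType) (N : nat).
Implicit Types (L : {set 'I_N.+1}).

(** The value 0 below 2 lets sums range over all sets [L], discarding those with a length 0 or 1. *)
Definition length_weight (m : nat) : R := if (2 <= m)%N then m%:R^-1 else 0.

Definition type_weight L : R := \prod_(m < N.+1) (if m \in L then length_weight m else 1).

Lemma type_weight_ge0 L : 0 <= type_weight L.
Proof.
apply: prodr_ge0 => m _; case: ifP => // _; rewrite /length_weight.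
by case: ifP => // _; rewrite invr_ge0.
Qed.

Lemma type_weight_eq0 L : ~~ [forall m in L, (2 <= m)%N] -> type_weight L = 0.
Proof.
rewrite negb_forall_in => /exists_inP[m mL m2].
by rewrite /type_weight (bigD1 m) //= mL /length_weight (negbTE m2) mul0r.
Qed.

Lemma type_weightE L : [forall m in L, (2 <= m)%N] ->
  type_weight L = (\prod_(m in L) m)%:R^-1.
Proof.
move=> /forall_inP L2; rewrite /type_weight -big_mkcond natr_prod -prodfV.
by apply: eq_bigr => m /L2 m2; rewrite /length_weight m2.
Qed.

(** The sum is the expansion of the product of the factors 1 + [length_weight m], which telescopes;
    m = 0 and m = 1 contribute the factor 1. *)
Lemma sum_type_weight : (0 < N)%N -> \sum_L type_weight L = N.+1%:R / 2.
Proof.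
move=> N0; rewrite -(bigA_distr _ _ (fun m : 'I_N.+1 => length_weight m) (fun _ => 1)).
rewrite -(big_mkord xpredT (fun m => length_weight m + 1)).
elim: N N0 => // -[_ _|M IH _].
  by rewrite big_nat_recr //= big_nat1 /length_weight /= !add0r mulr1 divff ?pnatr_eq0.
rewrite big_nat_recr //= IH // /length_weight /=.
have h : M.+2%:R != 0 :> R by rewrite pnatr_eq0.
have -> : M.+3%:R = M.+2%:R + 1 :> R by rewrite -addn1 natrD.
by field; rewrite -natrD pnatr_eq0.
Qed.

End Weights.

Section ShortCycleBound.
Variables (R : realFieldType) (T : finType) (x0 : T) (b : {perm T}) (N : nat).
Hypothesis b3 : forall y, #|porbit b y| = 3.

(** Only the set [L0] of short cycle lengths of [a] can contribute, and there the weight cancels the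
    bound of [card_planted]. *)
Lemma sum_planted_le1 (a : {perm T}) :
  \sum_L type_weight R L * #|plantedL b (N := N) L a|%:R <= 1.
Proof.
set L0 := [set m : 'I_N.+1 | [exists x, is_short b N a x && (#|porbit (a * b)%g x| == m)]].
have z L : L != L0 -> type_weight R L * #|plantedL b L a|%:R = 0.
  move=> LL; have [/forall_inP L2|/type_weight_eq0->] :=
    boolP [forall m in L, (2 <= m)%N]; last by rewrite mul0r.
  have [->|[v va]] := set_0Vmem (plantedL b L a); first by rewrite cards0 mulr0.
  by rewrite [X in X != _](planted_lengths L2 va) eqxx in LL.
rewrite (bigD1 L0) //= big1 ?addr0 //.
have [L2|/type_weight_eq0->] := boolP [forall m in L0, (2 <= m)%N];
  last by rewrite mul0r ler01.
rewrite type_weightE // mulrC ler_pdivrMr ?mul1r ?ler_nat.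
  by apply: card_planted => //; apply/forall_inP.
rewrite ltr0n prodn_cond_gt0 // => m mL; move/forall_inP: L2 => /(_ m mL); exact: ltnW.
Qed.

Let n := #|T|.
Let M := (N * N.+1)%N.
Let Q : R := #|matchings T|%:R.

Definition plant_error : R :=
  (M ^ 2 * (9 * N + 12))%:R / n%:R + (M * 9 * N.+1 ^ 2)%:R / (n - N.+1.*2)%:R.

Lemma no_short_planted (L : {set 'I_N.+1}) : (N.+1.*2 < n)%N ->
  #|no_short b N|%:R - plant_error * Q <=
  \sum_(a in matchings T) #|plantedL b L a|%:R.
Proof.
move=> nN; set I := cycle_index L; set P := (n ^ #|I|)%N.
have n0 : (0 < n)%N by apply: leq_ltn_trans nN.
have P0 : 0 < P%:R :> R by rewrite ltr0n expn_gt0 n0.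
have IM : (#|I| <= M)%N by apply: card_cycle_index.
have m0 : 0 < (n - N.+1.*2)%:R :> R by rewrite ltr0n subn_gt0.
have n0' : 0 < n%:R :> R by rewrite ltr0n.
have h1 := card_no_short b3 N (@cycle_succ_inj N L).
have h2 : #|far_bad b I N|%:R <= (M ^ 2 * (9 * N + 12))%:R / n%:R * Q * P%:R.
  rewrite -!mulrA [_^-1 * _]mulrC !mulrA ler_pdivlMr // -!natrM ler_nat.
  apply: leq_trans (card_far_bad b3 I N) _; rewrite !mulnA !leq_mul2r.
  by rewrite leq_sqr IM !orbT.
have h3 : #|self_bad b I N|%:R <=
    (M * 9 * N.+1 ^ 2)%:R / (n - N.+1.*2)%:R * Q * P%:R.
  rewrite -!mulrA [_^-1 * _]mulrC !mulrA ler_pdivlMr // -!natrM ler_nat.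
  apply: leq_trans (card_self_bad b3 I N) _.
  rewrite -[X in (_ <= X)%N]mulnA; apply: leq_mul => //.
  by rewrite -(mulnA M) -(mulnA #|I|) leq_mul // mulnA.
rewrite -(ler_pM2r P0) mulrBl lerBlDr /plant_error mulrDl mulrDl.
have {}h1 : #|no_short b N|%:R * P%:R <=
    (\sum_(a in matchings T) #|plantedL b L a|)%:R * P%:R +
    (#|far_bad b I N|%:R + #|self_bad b I N|%:R) :> R.
  by rewrite -!natrM -!natrD ler_nat addnA.
by rewrite -natr_sum; apply: le_trans h1 _; rewrite lerD2l lerD.
Qed.

(** Average [no_short_planted] over [L] with weights [type_weight]: the left side is multiplied by
    (N + 1) / 2, while the right side is at most the number of matchings. *)
Lemma no_short_bound : (0 < N)%N -> (N.+1.*2 < n)%N ->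
  #|no_short b N|%:R <= (plant_error + 2 / N.+1%:R) * Q.
Proof.
move=> N0 nN; rewrite mulrDl -lerBlDl.
set d := _ - _.
have : \sum_(L : {set 'I_N.+1}) type_weight R L * d <= Q.
  apply: (@le_trans _ _ (\sum_(a in matchings T) \sum_L
    type_weight R L * #|plantedL b (N := N) L a|%:R)).
    rewrite exchange_big; apply: ler_sum => L _ /=; rewrite -mulr_sumr.
    by rewrite ler_wpM2l ?type_weight_ge0 // no_short_planted.
  rewrite /Q -sumr_const; apply: ler_sum => a _; exact: sum_planted_le1.
rewrite -mulr_suml sum_type_weight // => h.
have N1 : 0 < N.+1%:R :> R by rewrite ltr0n.
have -> : 2 / N.+1%:R * Q = Q / (N.+1%:R / 2) by field; rewrite nat1r pnatr_eq0.
by rewrite ler_pdivlMr ?divr_gt0 // mulrC.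
Qed.

End ShortCycleBound.

(** * From pairs of permutations to silhouette graphs *)

Section Silhouettes.
Local Open Scope nat_scope.

(** If the group is not transitive, the orbit of vertex 0 is a proper nonempty invariant set. *)
Lemma silhouette_or_disconnected n (a b : {perm 'I_n}) : 0 < n ->
  a \in matchings 'I_n -> b \in triangle_perms 'I_n ->
  ((a, b) \in silhouettes n) || (a \in disconnected b).
Proof.
move=> n0 aM bT; rewrite /silhouettes [X in X || _]inE /is_silhouette /=.
have -> : [forall v, #|porbit a v| == 2] by move: aM; rewrite inE.
have -> : [forall v, #|porbit b v| == 3] by move: bT; rewrite inE.
rewrite /=; set G := <<_>>%g.
have [//|ntr] /= := boolP [transitive G, on _ | _].
pose x0 : 'I_n := Ordinal n0; pose S := orbit 'P G x0.
have st c : c \in G -> stable c S.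
  by move=> cG; apply/stableP=> x; rewrite /S -(orbit_actr _ x0 x cG) /= apermE.
rewrite inE aM; apply/existsP; exists S; apply/and4P; split.
- by apply: st; rewrite mem_gen // !inE eqxx.
- by apply: st; rewrite mem_gen // !inE eqxx orbT.
- by apply/set0Pn; exists x0; apply: orbit_refl.
- apply: contra ntr => /eqP ST; apply/imsetP; exists x0; rewrite ?inE //.
Qed.

Lemma card_silhouettes q : 0 < q ->
  #|matchings 'I_(6 * q)| * #|triangle_perms 'I_(6 * q)| <= 2 * #|silhouettes (6 * q)|.
Proof.
move=> q0; set n := 6 * q; have n0 : 0 < n by rewrite muln_gt0.
set D := [set g : {perm 'I_n} * {perm 'I_n} |
           (g.1 \in disconnected g.2) && (g.2 \in triangle_perms 'I_n)].
have hD : 2 * #|D| <= #|matchings 'I_n| * #|triangle_perms 'I_n|.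
  rewrite /D (card_pair_swap (fun a b => (a \in disconnected b) && (b \in triangle_perms 'I_n))).
  rewrite [X in _ <= X]mulnC -sum_nat_const big_distrr [X in _ <= X]big_mkcond /=.
  apply: leq_sum => b _; case: (boolP (b \in _)) => [bT|_]; last first.
    by rewrite eq_card0 // => a; rewrite inE andbF.
  have b3 y : #|porbit b y| = 3 by move: bT; rewrite inE => /forallP/(_ y)/eqP.
  apply: leq_trans (card_disconnected b3 (card_ord n) q0).
  by rewrite leq_mul2l /=; apply: subset_leq_card; apply/subsetP=> a; rewrite inE andbT.
have : setX (matchings 'I_n) (triangle_perms 'I_n) \subset silhouettes n :|: D.
  apply/subsetP=> -[a b]; rewrite in_setX /= => /andP[aM bT].
  by rewrite in_setU [_ \in D]in_set /= bT andbT silhouette_or_disconnected.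
move/subset_leq_card; rewrite cardsX => /leq_trans/(_ (leq_card_setU _ _)) h.
rewrite -(leq_add2r (#|matchings 'I_n| * #|triangle_perms 'I_n|)) addnn -mul2n.
apply: leq_trans (leq_mul (leqnn 2) h) _; rewrite mulnDr leq_add2l; exact: hD.
Qed.

Lemma silhouette_parts n (g : {perm 'I_n} * {perm 'I_n}) : g \in silhouettes n ->
  g.1 \in matchings 'I_n /\ g.2 \in triangle_perms 'I_n.
Proof. by rewrite in_set => /and3P[h1 h2 _]; rewrite !in_set. Qed.

End Silhouettes.

(** * Probability estimates *)

Section Probability.
Variables (R : realType) (alpha : R) (q : nat).
Let n := (6 * q)%N.
Let N := Num.trunc (n%:R `^ alpha : R).

Lemma no_short_cycle_short (g : {perm 'I_n} * {perm 'I_n}) : g \in silhouettes n ->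
  ~~ has_short_ab_cycle alpha g -> g.1 \in no_short g.2 N.
Proof.
move=> gs ng; have [gM _] := silhouette_parts gs.
rewrite inE gM; apply/forallP=> x; apply: contra ng => /andP[h1 h2].
apply/exists_inP; exists (porbit (ab_perm g) x); first by apply/imsetP; exists x.
by rewrite h1 /= -truncn_ge_nat ?powR_ge0.
Qed.

(** Summing the hypothesis over all [b] bounds the exceptional pairs by [e] times the number of all
    pairs, of which at least half are silhouettes. *)
Lemma prob_no_short_le (e : R) : (0 < q)%N ->
  (forall b : {perm 'I_n}, (forall y, #|porbit b y| = 3%N) ->
     #|no_short b N|%:R <= e * #|matchings 'I_n|%:R) ->
  0 <= 1 - finset_prob R (silhouettes n) (has_short_ab_cycle alpha (n := n)) <= 2 * e.
Proof.
move=> q0 hb.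
have hs := card_silhouettes q0; rewrite -/n in hs.
have M0 := matchings_gt0 q; have T0 := triangle_perms_gt0 q; rewrite -/n in M0 T0.
have s0 : (0 < #|silhouettes n|)%N.
  have p : (0 < #|matchings 'I_n| * #|triangle_perms 'I_n|)%N by rewrite muln_gt0 M0.
  by have := leq_trans p hs; rewrite muln_gt0.
have s0R : 0 < #|silhouettes n|%:R :> R by rewrite ltr0n.
set A := [set g in silhouettes n | ~~ has_short_ab_cycle alpha g].
have -> : 1 - finset_prob R (silhouettes n) (has_short_ab_cycle alpha (n := n)) =
    #|A|%:R / #|silhouettes n|%:R.
  rewrite /finset_prob -[X in X - _](divff (lt0r_neq0 s0R)) -mulrBl; congr (_ / _).
  apply/eqP; rewrite subr_eq -natrD eqr_nat; apply/eqP.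
  rewrite -(cardsID [set g | has_short_ab_cycle alpha g] (silhouettes n)) addnC.
  by congr (_ + _)%N; apply: eq_card => g; rewrite !in_set // andbC.
rewrite divr_ge0 //= ler_pdivrMr //.
have hA : #|A|%:R <= \sum_(b in triangle_perms 'I_n) #|no_short b N|%:R :> R.
  rewrite -natr_sum ler_nat.
  have -> : (\sum_(b in triangle_perms 'I_n) #|no_short b N| =
     \sum_b #|[set a | (a \in no_short b N) && (b \in triangle_perms 'I_n)]|)%N.
    rewrite [LHS]big_mkcond; apply: eq_bigr => b _; case: ifP => _.
      by apply: eq_card => a; rewrite [in RHS]in_set andbT.
    by rewrite eq_card0 // => a; rewrite in_set andbF.
  rewrite -(card_pair_swap (fun a b => (a \in no_short b N) && (b \in triangle_perms 'I_n))).
  apply: subset_leq_card; apply/subsetP=> g /setIdP[gs gn].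
  by rewrite in_set no_short_cycle_short //; case: (silhouette_parts gs).
apply: le_trans hA _.
have e0 : 0 <= e.
  have [b bT] : exists b, b \in triangle_perms 'I_n by apply/set0Pn; rewrite -card_gt0.
  have b3 y : #|porbit b y| = 3%N by move: bT; rewrite inE => /forallP/(_ y)/eqP.
  have := le_trans (ler0n R _) (hb b b3); rewrite pmulr_lge0 // ltr0n //.
apply: (@le_trans _ _ (e * (#|matchings 'I_n| * #|triangle_perms 'I_n|)%:R)).
  rewrite natrM mulrA mulr_natr -sumr_const; apply: ler_sum => b bT.
  by apply: hb => y; move: bT; rewrite inE => /forallP/(_ y)/eqP.
by rewrite (mulrC 2) -mulrA ler_wpM2l // -natrM ler_nat.
Qed.

End Probability.

(** With N <= y the two error terms are at most 84 y^5 / n and 144 y^4 / n, and y^6 <= n turns them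
    into 84 / y and 144 / y. *)
Lemma plant_error_le (R : realType) (T : finType) (N : nat) (y : R) :
  1 <= y -> N%:R <= y -> (16 <= #|T|)%N -> y ^+ 6 <= #|T|%:R ->
  (N.+1.*2 < #|T|)%N /\ plant_error R T N <= 228 / y.
Proof.
move=> y1 Ny T16 yT; set n := #|T| in T16 yT *.
have y0 : 0 < y by lra.
have T16R : 16 <= n%:R :> R by rewrite (ler_nat _ 16).
(* This gives 2 (N + 1) <= 4 y <= n / 2, so the denominator n - 2 (N + 1) is at least n / 2. *)
have n8 : 8 * y <= n%:R.
  have [y2|/ltW y2] := lerP y 2; first by lra.
  apply: le_trans yT; rewrite exprS mulrC ler_wpM2l ?ltW //.
  have : 2 ^+ 5 <= y ^+ 5 by rewrite lerXn2r ?nnegrE // ltW.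
  by rewrite -natrX; lra.
have d2 : N.+1.*2%:R = 2 * (N%:R + 1) :> R by rewrite -muln2 natrM -natr1 mulrC.
have nN : (N.+1.*2 < n)%N by rewrite -(ltr_nat R) d2; lra.
split=> //; rewrite /plant_error -/n.
have p1 : (N * N.+1)%:R <= 2 * y ^+ 2.
  rewrite natrM -natr1 expr2; have := ler0n R N; nra.
have p2 : (9 * N + 12)%:R <= 21 * y by rewrite natrD natrM; lra.
have p3 : (N.+1 ^ 2)%:R <= 4 * y ^+ 2.
  by rewrite natrX -natr1 !expr2; have := ler0n R N; nra.
have n0 : 0 < n%:R :> R by lra.
have e1 : ((N * N.+1) ^ 2 * (9 * N + 12))%:R / n%:R <= 84 / y.
  rewrite ler_pdivrMr // mulrAC ler_pdivlMr // natrM natrX.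
  apply: (@le_trans _ _ ((2 * y ^+ 2) ^+ 2 * (21 * y) * y)).
    rewrite ler_wpM2r ?(ltW y0) // ler_pM ?exprn_ge0 //.
    by rewrite lerXn2r ?nnegrE // mulr_ge0 // sqr_ge0.
  have -> : (2 * y ^+ 2) ^+ 2 * (21 * y) * y = 84 * y ^+ 6 by ring.
  by rewrite ler_wpM2l.
have e2 : (N * N.+1 * 9 * N.+1 ^ 2)%:R / (n - N.+1.*2)%:R <= 144 / y.
  have h : n%:R / 2 <= (n - N.+1.*2)%:R :> R.
    by rewrite natrB ?(ltnW nN) // d2; lra.
  have h0 : 0 < (n - N.+1.*2)%:R :> R by lra.
  rewrite ler_pdivrMr // mulrAC ler_pdivlMr // natrM natrM.
  apply: (@le_trans _ _ ((2 * y ^+ 2 * 9) * (4 * y ^+ 2) * y)).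
    by rewrite ler_wpM2r ?(ltW y0) // ler_pM // ler_wpM2r.
  have -> : 2 * y ^+ 2 * 9 * (4 * y ^+ 2) * y = 72 * y ^+ 5 by ring.
  have : y ^+ 5 <= y ^+ 6 by rewrite ler_weXn2l.
  by lra.
have -> : 228 / y = 84 / y + 144 / y by rewrite -mulrDl; congr (_ / _); lra.
exact: lerD.
Qed.

Theorem proposition6p3 (R : realType) (alpha : R)
    (alpha_gt0 : 0 < alpha) (alpha_lt : alpha < 6^-1) :
  (fun n : nat => 1 - finset_prob R (silhouettes n)
                        (has_short_ab_cycle alpha (n := n)) : R^o)
  =O_ (oo_multiples_of 6) (fun n : nat => n%:R `^ (- alpha) : R^o).
Proof.
(* 460 = 2 * (228 + 2): the factor 2 for connectedness, 228 from [plant_error_le] and 2 from the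
   main term. The threshold 16 is the one of [plant_error_le]. *)
apply/eqO_exP; exists 460 => //.
exists 16%N => // n /= n16 /dvdnP[q nq].
rewrite mulnC in nq; subst n.
have q0 : (0 < q)%N by move: n16 => /=; case: q.
set n := (6 * q)%N in n16 *; set y := n%:R `^ alpha : R.
have n1 : 1 <= n%:R :> R by rewrite (ler_nat _ 1) (leq_trans _ n16).
have y1 : 1 <= y by rewrite -(powRr0 n%:R) ler_powR // ltW.
have y0 : 0 < y by lra.
have Ny : (Num.trunc y)%:R <= y by rewrite truncn_le // ltW.
have yN : y < (Num.trunc y).+1%:R by rewrite truncnS_gt // ltW.
have N0 : (0 < Num.trunc y)%N by rewrite truncn_gt0.
(* This is where alpha < 1/6 enters: y^6 = n^(6 alpha) <= n. *)
have y6 : y ^+ 6 <= #|'I_n|%:R.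
  rewrite card_ord -powR_mulrn ?powR_ge0 // -powRrM -[X in _ <= X]powRr1 ?ler0n //.
  by rewrite ler_powR //; lra.
have T16 : (16 <= #|'I_n|)%N by rewrite card_ord.
have [nN err] := plant_error_le y1 Ny T16 y6.
have bound (b : {perm 'I_n}) : (forall y, #|porbit b y| = 3%N) ->
    #|no_short b (Num.trunc y)|%:R <= (230 / y) * #|matchings 'I_n|%:R.
  move=> b3; have x0 : 'I_n := Ordinal (leq_trans (isT : 0 < 16)%N n16).
  apply: le_trans (no_short_bound R x0 b3 N0 nN) _.
  rewrite ler_wpM2r // (_ : 230 / y = 228 / y + 2 / y); last first.
    by rewrite -mulrDl; congr (_ / _); lra.
  (* The main term 2 / (N + 1) is at most 2 / y because y < N + 1. *)
  by rewrite lerD // ler_wpM2l // lef_pV2 ?posrE ?ltW.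
have /andP[p0 p1] := prob_no_short_le q0 bound.
rewrite ger0_norm // powRN ger0_norm ?invr_ge0 ?powR_ge0 // -/y.
by apply: le_trans p1 _; rewrite mulrA; lra.
Qed.
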